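(* Fix $n\in\mathbf{N}$, $n\ge 1$, and let $$\Omega:(k)\rightsquigarrow (1)^{a_1^{(k)}}(2)^{a_2^{(k)}}\cdots(n)^{a_n^{(k)}},\qquad 1\le k\le n,$$ be a family of succession rules, where the $a_j^{(k)}$ are nonnegative integers. For $b\in\{1,\dots,n\}$ let $\Omega^{(b)}$ be the succession rule of the family $\Omega$ having axiom $(b)$. (i) If $\Omega^{(b)}$ is unimodal for all $b\le n$, then the sequence $(a_1^{(k)},a_2^{(k)},\ldots,a_n^{(k)})$ is unimodal for all $k\le n$. (ii) Conversely, if for all $k\le n$ the sequences $(a_1^{(k)},a_2^{(k)},\ldots,a_n^{(k)})$ are unimodal and all have the maximum in the same position (that is, there is an index $i$ such that each of these sequences attains its maximum at index $i$), then $\Omega^{(b)}$ is unimodal for all $b\le n$.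
   Context: A finite sequence $c_1,\dots,c_n$ is unimodal if there is an index $i$ with $c_1\le\cdots\le c_{i-1}\le c_i\ge c_{i+1}\ge\cdots\ge c_n$. A family of (finite) succession rules on labels $(1),\dots,(n)$ is a system of productions $(k)\rightsquigarrow (1)^{a_1^{(k)}}\cdots(n)^{a_n^{(k)}}$, $1\le k\le n$, meaning that a node labelled $(k)$ has exactly $a_j^{(k)}$ children labelled $(j)$, for each $j$. Choosing an axiom $(b)$ gives a succession rule $\Omega^{(b)}$. Its generating tree is the rooted tree whose root (level $0$) is labelled $(b)$ and in which each node produces children according to the productions. The ECO matrix of $\Omega^{(b)}$ is the matrix with rows indexed by levels $l=0,1,2,\dots$ and columns indexed by labels $j=1,\dots,n$, whose $(l,j)$ entry is the number of nodes labelled $(j)$ at level $l$ of the generating tree. A succession rule is called unimodal if every row of its ECO matrix is a unimodal sequence. *)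

(* Defs.v *)
From mathcomp Require Import all_boot.

Set Implicit Arguments.
Unset Strict Implicit.
Unset Printing Implicit Defensive.

Definition unimodal (n : nat) (c : 'I_n -> nat) : Prop :=
  exists i : 'I_n,
    (forall j k : 'I_n, k = j.+1 :> nat -> k <= i -> c j <= c k) /\
    (forall j k : 'I_n, k = j.+1 :> nat -> i <= j -> c k <= c j).

Definition max_at (n : nat) (c : 'I_n -> nat) (i : 'I_n) : Prop :=
  forall j : 'I_n, c j <= c i.

(* Possibly infinite, finitely branching rooted trees with labels in L;
   a node is identified with the subtree hanging from it. *)
CoInductive ltree (L : Type) : Type :=
  Node (x : L) (J : finType) (child : J -> ltree L).

Definition label (L : Type) (t : ltree L) : L := let: Node x _ _ := t in x.

Definition children (L : Type) (t : ltree L) : seq (ltree L) :=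
  let: Node _ J child := t in [seq child i | i <- enum J].

(* One occurrence for each node at level l. *)
Fixpoint level (L : Type) (t : ltree L) (l : nat) : seq (ltree L) :=
  if l is l'.+1 then flatten [seq children s | s <- level t l'] else [:: t].

(* The label (k), 1 <= k <= n, is the ordinal of value k - 1, and a k j is the
   exponent of (j) in the production of (k). *)
Definition rule_family (n : nat) : Type := 'I_n -> 'I_n -> nat.

(* The children of a node labelled k are indexed by the pairs of a label j and
   a copy number below a k j; such a child has label j. *)
CoFixpoint generating_tree (n : nat) (a : rule_family n) (b : 'I_n) :
    ltree 'I_n :=
  @Node 'I_n b {j : 'I_n & 'I_(a b j)} (fun c => generating_tree a (tag c)).

Definition eco_matrix (n : nat) (a : rule_family n) (b : 'I_n)
    (l : nat) (j : 'I_n) : nat :=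
  count (fun s => label s == j) (level (generating_tree a b) l).

Definition unimodal_rule (n : nat) (a : rule_family n) (b : 'I_n) : Prop :=
  forall l : nat, unimodal (eco_matrix a b l).

(* Main.v *)
Require Import Defs.
From mathcomp Require Import all_boot.

(** The generating tree unfolds so that each row of the ECO matrix after the
    first is a sum of productions, one for each node of the previous level;
    row 1 is the production of the axiom, which gives (i). For (ii), a unimodal
    sequence rises up to, and falls from, every index where its maximum is
    attained, and sequences with a common such index are closed under sums. *)

(** Exposes the index that [unimodal] hides behind an existential, so that several sequences can be
    required to share it. *)
Definition peak_at {n : nat} (c : 'I_n -> nat) (i : 'I_n) : Prop :=
  (forall j k : 'I_n, k = j.+1 :> nat -> k <= i -> c j <= c k) /\
  (forall j k : 'I_n, k = j.+1 :> nat -> i <= j -> c k <= c j).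

Lemma peak_at_le_left {n : nat} {c : 'I_n -> nat} {i j k : 'I_n} :
  peak_at c i -> j <= k -> k <= i -> c j <= c k.
Proof.
move=> [up _] lejk leki.
have [m def_k] : exists m, k = m + j :> nat by exists (k - j); rewrite subnK.
elim: m => [|m IHm] in k lejk leki def_k *; first by rewrite (val_inj def_k).
have ltmn : m + j < n by rewrite -addSn -def_k ltnW.
have ltk : Ordinal ltmn < k by rewrite def_k.
apply: leq_trans (IHm (Ordinal ltmn) _ _ _) (up _ _ _ leki) => //.
- exact: leq_addl.
- exact: leq_trans (ltnW ltk) leki.
Qed.

Lemma peak_at_le_right {n : nat} {c : 'I_n -> nat} {i j k : 'I_n} :
  peak_at c i -> i <= j -> j <= k -> c k <= c j.
Proof.
move=> [_ down] leij lejk.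
have [m def_k] : exists m, k = m + j :> nat by exists (k - j); rewrite subnK.
elim: m => [|m IHm] in k lejk def_k *; first by rewrite (val_inj def_k).
have ltmn : m + j < n by rewrite -addSn -def_k ltnW.
have le_jm : j <= Ordinal ltmn by exact: leq_addl.
apply: leq_trans (down (Ordinal ltmn) k _ _) (IHm _ _ _) => //.
exact: leq_trans leij le_jm.
Qed.

Lemma unimodal_peak_at_max {n : nat} {c : 'I_n -> nat} {i : 'I_n} :
  unimodal c -> max_at c i -> peak_at c i.
Proof.
move=> [p peak_p] max_i; have [up down] := peak_p.
split=> j k def_k.
(* If [k] lies beyond the peak [p], then [p < k <= i], and the descent from [p] gives [c i <= c k],
   while [c j <= c i] by maximality. The other half is symmetric. *)
- move=> leki; have [lekp | ltpk] := leqP k p; first exact: up.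
  by apply: leq_trans (max_i j) (peak_at_le_right peak_p (ltnW ltpk) leki).
- move=> leij; have [lepj | ltjp] := leqP p j; first exact: down.
  by apply: leq_trans (max_i k) (peak_at_le_left peak_p leij (ltnW ltjp)).
Qed.

Lemma peak_at_sum {n : nat} {I : Type} (s : seq I) (c : I -> 'I_n -> nat)
    (i : 'I_n) :
  (forall x, peak_at (c x) i) -> peak_at (fun j => \sum_(x <- s) c x j) i.
Proof.
move=> peak_c; split=> j k def_k le; apply: leq_sum => x _;
  have [up down] := peak_c x; [exact: up | exact: down].
Qed.

Lemma eq_unimodal {n : nat} {c d : 'I_n -> nat} :
  c =1 d -> unimodal c -> unimodal d.
Proof.
by move=> eq_cd [i [up down]]; exists i; split=> j k; rewrite -!eq_cd;
  [exact: up | exact: down].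
Qed.

Lemma unimodal_delta {n : nat} (b : 'I_n) : unimodal (fun j => b == j : nat).
Proof.
exists b; split=> j k def_k le.
- by have -> : (b == j) = false by apply/eqP=> eqb; rewrite eqb def_k ltnn in le.
- by have -> : (b == k) = false by apply/eqP=> eqb; rewrite eqb def_k ltnn in le.
Qed.

Lemma count_label_children {n : nat} (a : rule_family n) (x j : 'I_n) :
  count (fun s => label s == j) (children (generating_tree a x)) = a x j.
Proof.
rewrite count_map -sum1_count big_enum_cond /=.
(* Splitting the dependent pairs turns the count into a double sum over labels and copy numbers,
   where only the label [j] contributes. *)
rewrite -(@sig_big_dep _ _ _ _ (fun i => 'I_(a x i)) xpredT
            (fun i _ => i == j) (fun _ _ => 1)).
rewrite (bigD1 j) //= [X in _ + X]big1 => [|i neq_ij]; last first.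
  by rewrite big_pred0 // => y; apply: negbTE.
by rewrite (eq_bigl xpredT) => [|y]; rewrite ?eqxx // sum1_card card_ord addn0.
Qed.

(** The subtree at any node is the generating tree of the label of that node, so a list [s] of
    labels determines a whole level. *)
Lemma level_generating_tree {n : nat} (a : rule_family n) (b : 'I_n) l :
  exists s, level (generating_tree a b) l = map (generating_tree a) s.
Proof.
elim: l => [|l [s IHl]] /=; first by exists [:: b].
(* Each label [x] is replaced by the labels of its children, with multiplicity. *)
exists (flatten [seq [seq tag c | c : {j : 'I_n & 'I_(a x j)}] | x <- s]).
rewrite IHl map_flatten -!map_comp; congr flatten.
by apply: eq_map => x /=; rewrite /image_mem -map_comp.
Qed.

Lemma eco_matrixS {n : nat} (a : rule_family n) (b : 'I_n) l :
  exists s, eco_matrix a b l.+1 =1 fun j => \sum_(x <- s) a x j.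
Proof.
have [s def_l] := level_generating_tree a b l; exists s => j.
rewrite /eco_matrix /= def_l count_flatten -!map_comp sumnE big_map.
by apply: eq_bigr => x _; apply: count_label_children.
Qed.

Lemma eco_matrix0 {n : nat} (a : rule_family n) (b j : 'I_n) :
  eco_matrix a b 0 j = (b == j).
Proof. exact: addn0. Qed.

Lemma eco_matrix1 {n : nat} (a : rule_family n) (b j : 'I_n) :
  eco_matrix a b 1 j = a b j.
Proof. by rewrite /eco_matrix /level /= cats0 count_label_children. Qed.

Theorem theorem4p1 (n : nat) (hn : 1 <= n) (a : rule_family n) :
  ((forall b : 'I_n, unimodal_rule a b) -> forall k : 'I_n, unimodal (a k)) /\
  ((exists i : 'I_n, forall k : 'I_n, unimodal (a k) /\ max_at (a k) i) ->
   forall b : 'I_n, unimodal_rule a b).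
Proof.
split=> [uni k | [i max_i] b [|l]].
- exact: eq_unimodal (eco_matrix1 a k) (uni k 1).
(* Row 0 is the indicator of the axiom: it peaks at [b], possibly not at the common index [i], so it
   is treated apart. *)
- by apply: eq_unimodal (unimodal_delta b) => j; rewrite eco_matrix0.
- have [s def_row] := eco_matrixS a b l.
  apply: eq_unimodal (fsym def_row) _; exists i; apply: peak_at_sum => x.
  by have [uni_x max_x] := max_i x; apply: unimodal_peak_at_max.
Qed.
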